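(* Let $\mathbb{K}$ be a field and let $\mathcal{V}$ be the variety of $\mathbb{K}$-algebras determined by a set $I$ of non-associative polynomials. Then the inclusion functor $\mathcal{V}\to\mathsf{Alg}_{\mathbb{K}}$ has a left adjoint $L\colon\mathsf{Alg}_{\mathbb{K}}\to\mathcal{V}$.
   Context: Fix a field $\mathbb{K}$. A (non-associative) algebra over $\mathbb{K}$ is a $\mathbb{K}$-vector space $A$ with a bilinear multiplication $A\times A\to A$ (no associativity, unit, etc. is assumed). Morphisms are linear maps preserving the multiplication; the resulting category is $\mathsf{Alg}_{\mathbb{K}}$. Let $X=\{x_1,x_2,\dots\}$ be a countable set of variables and let $\mathbb{K}[M(X)]$ be the free non-associative $\mathbb{K}$-algebra on $X$ (the vector space with basis the free magma $M(X)$ on $X$, with bilinearly extended multiplication); its elements are called (non-associative) polynomials. For $\psi=\psi(x_1,\dots,x_n)\in\mathbb{K}[M(X)]$ and $a_1,\dots,a_n$ in an algebra $A$, $\psi(a_1,\dots,a_n)$ is the image of $\psi$ under the unique algebra morphism $\mathbb{K}[M(X)]\to A$ sending $x_i$ to $a_i$ for $1\le i\le n$ and all other variables to $0$. The polynomial $\psi$ is an identity of $A$ if $\psi(a_1,\dots,a_n)=0$ for all $a_1,\dots,a_n\in A$. For a subset $I\subseteq\mathbb{K}[M(X)]$, the variety of $\mathbb{K}$-algebras determined by $I$ is the full subcategory of $\mathsf{Alg}_{\mathbb{K}}$ consisting of all algebras that satisfy all identities in $I$. *)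

(* Defs.v *)
From HB Require Import structures.
From mathcomp Require Import all_boot all_algebra.
From mathcomp Require Import finmap.
From mathcomp.multinomials Require Import monalg.
From Stdlib Require Import FunctionalExtensionality ProofIrrelevance.

Set Implicit Arguments.
Unset Strict Implicit.
Unset Printing Implicit Defensive.

Import GRing.Theory.
Local Open Scope ring_scope.

(* Morphisms are compared with Leibniz equality; [comp g f] is "g after f". *)
Record category := Category {
  obj :> Type;
  hom : obj -> obj -> Type;
  idm : forall a, hom a a;
  comp : forall a b c, hom b c -> hom a b -> hom a c;
  comp_idl : forall a b (f : hom a b), comp (idm b) f = f;
  comp_idr : forall a b (f : hom a b), comp f (idm a) = f;
  compA : forall a b c d (h : hom c d) (g : hom b c) (f : hom a b),
    comp h (comp g f) = comp (comp h g) f }.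

Arguments hom {_} _ _.
Arguments idm {_} a.
Arguments comp {_ _ _ _} _ _.

Record functor (C D : category) := Functor {
  fobj :> C -> D;
  fmap : forall a b, hom a b -> hom (fobj a) (fobj b);
  fmap_id : forall a, fmap (idm a) = idm (fobj a);
  fmap_comp : forall a b c (g : hom b c) (f : hom a b),
    fmap (comp g f) = comp (fmap g) (fmap f) }.

Arguments fmap {C D} _ {a b} _.

(* An adjunction L -| U: a bijection hom (L c) d ~ hom c (U d), natural in both
   variables. *)
Record adjunction (C D : category) (L : functor C D) (U : functor D C) :=
  Adjunction {
    transpose : forall c d, hom (L c) d -> hom c (U d);
    transpose_bij : forall c d, bijective (@transpose c d);
    transpose_natl : forall c c' d (f : hom c' c) (g : hom (L c) d),
      transpose (comp g (fmap L f)) = comp (transpose g) f;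
    transpose_natr : forall c d d' (g : hom (L c) d) (h : hom d d'),
      transpose (comp h g) = comp (fmap U h) (transpose g) }.

Definition is_left_adjoint (C D : category) (L : functor C D)
  (U : functor D C) : Prop := inhabited (adjunction L U).

Section FullSubcategory.
Variables (C : category) (P : C -> Prop).

Definition full_subcategory : category :=
  @Category {a : C | P a} (fun a b => hom (sval a) (sval b))
    (fun a => idm (sval a)) (fun a b c g f => comp g f)
    (fun a b f => comp_idl f) (fun a b f => comp_idr f)
    (fun a b c d h g f => compA h g f).

Definition inclusion : functor full_subcategory C :=
  @Functor full_subcategory C (fun a => sval a) (fun a b f => f)
    (fun a => erefl) (fun a b c g f => erefl).

End FullSubcategory.

Record nalg (K : fieldType) := NAlg {
  carrier :> lmodType K;
  nmul : {bilinear carrier -> carrier -> carrier} }.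

Arguments nmul {K n}.

Section AlgebraMorphisms.
Variable K : fieldType.
Implicit Types A B C : nalg K.

Definition mul_preserving A B (f : {linear A -> B}) : Prop :=
  {morph f : x y / nmul x y}.

Definition nalg_hom A B := {f : {linear A -> B} | mul_preserving f}.

Definition nalg_fun A B (f : nalg_hom A B) : A -> B := sval f.
Coercion nalg_fun : nalg_hom >-> Funclass.

Lemma nalg_homP A B (f g : nalg_hom A B) : f =1 g -> f = g.
Proof.
case: f g => [[f [[[cf0 cfD]] [cfZ]]] fM] [[g [[[cg0 cgD]] [cgZ]]] gM].
rewrite /nalg_fun /= => /functional_extensionality fg.
move: cg0 cgD cgZ gM; rewrite -fg => cg0 cgD cgZ gM.
rewrite (proof_irrelevance _ cg0 cf0) (proof_irrelevance _ cgD cfD).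
by rewrite (proof_irrelevance _ cgZ cfZ) (proof_irrelevance _ gM fM).
Qed.

Lemma nalg_idP A : mul_preserving (idfun : {linear A -> A}).
Proof. by []. Qed.

Definition nalg_id A : nalg_hom A A := exist _ _ (@nalg_idP A).

Lemma nalg_compP A B C (g : nalg_hom B C) (f : nalg_hom A B) :
  mul_preserving (sval g \o sval f : {linear A -> C}).
Proof. by move=> x y /=; rewrite (svalP f) (svalP g). Qed.

Definition nalg_comp A B C (g : nalg_hom B C) (f : nalg_hom A B) :
  nalg_hom A C := exist _ _ (nalg_compP g f).

Definition Alg : category.
Proof.
refine (@Category (nalg K) nalg_hom nalg_id nalg_comp _ _ _).
- by move=> A B f; apply: nalg_homP.
- by move=> A B f; apply: nalg_homP.
- by move=> A B C D h g f; apply: nalg_homP.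
Defined.

End AlgebraMorphisms.

Arguments Alg K : clear implicits.

(* The free magma M(X); [MVar i] stands for the variable x_(i+1). *)
Inductive magma := MVar of nat | MMul of magma & magma.

Fixpoint magma_tree (m : magma) : GenTree.tree nat :=
  match m with
  | MVar i => GenTree.Leaf i
  | MMul u v => GenTree.Node 0 [:: magma_tree u; magma_tree v]
  end.

Fixpoint tree_magma (t : GenTree.tree nat) : option magma :=
  match t with
  | GenTree.Leaf i => Some (MVar i)
  | GenTree.Node _ [:: u; v] =>
      if (tree_magma u, tree_magma v) is (Some u', Some v')
      then Some (MMul u' v') else None
  | _ => None
  end.

Lemma magma_treeK : pcancel magma_tree tree_magma.
Proof. by elim=> //= u -> v ->. Qed.

HB.instance Definition _ := Countable.copy magma (pcan_type magma_treeK).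

Section FreeAlgebra.
Variable K : fieldType.

Local Notation poly := {malg K[magma]}.

Definition pmul (f g : poly) : poly :=
  \sum_(u <- msupp f) \sum_(v <- msupp g) << f@_u * g@_v *g MMul u v >>.

Lemma linear_msupp (V : lmodType K) (h : magma -> V) :
  linear (fun f : poly => \sum_(u <- msupp f) f@_u *: h u).
Proof.
move=> c f g.
have big_ext (p : poly) (d : {fset magma}) : (msupp p `<=` d)%fset ->
    \sum_(u <- msupp p) p@_u *: h u = \sum_(u <- d) p@_u *: h u.
  move=> pd; apply: big_fset_incl => // u _ /mcoeff_outdom ->.
  by rewrite scale0r.
pose d := (msupp f `|` msupp g `|` msupp (c *: f + g))%fset.
have sf : (msupp f `<=` d)%fset by rewrite /d -fsetUA fsubsetUl.
have sg : (msupp g `<=` d)%fset.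
  by rewrite /d (fsetUC (msupp f)) -fsetUA fsubsetUl.
have sh : (msupp (c *: f + g) `<=` d)%fset by rewrite fsubsetUr.
rewrite (big_ext _ _ sf) (big_ext _ _ sg) (big_ext _ _ sh).
rewrite scaler_sumr -big_split /=; apply: eq_bigr => u _.
by rewrite mcoeffD mcoeffZ scalerDl scalerA.
Qed.

Lemma scale_malgU (c d : K) (m : magma) :
  c *: << d *g m >> = << c * d *g m >> :> poly.
Proof. by apply/malgP => k; rewrite mcoeffZ !mcoeffU mulrnAr. Qed.

Lemma pmulEl f g : pmul f g =
  \sum_(u <- msupp f) f@_u *: \sum_(v <- msupp g) g@_v *: << MMul u v >>.
Proof.
apply: eq_bigr => u _; rewrite scaler_sumr; apply: eq_bigr => v _.
by rewrite !scale_malgU mulr1.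
Qed.

Lemma pmulEr f g : pmul f g =
  \sum_(v <- msupp g) g@_v *: \sum_(u <- msupp f) f@_u *: << MMul u v >>.
Proof.
rewrite /pmul exchange_big; apply: eq_bigr => v _.
rewrite scaler_sumr; apply: eq_bigr => u _.
by rewrite !scale_malgU mulr1 mulrC.
Qed.

Lemma pmul_bilinear : bilinear_for *:%R *:%R pmul.
Proof.
split=> [g|f] c p q /=.
- by rewrite !pmulEl (linear_msupp _ c p q).
- by rewrite !pmulEr (linear_msupp _ c p q).
Qed.

HB.instance Definition _ :=
  bilinear_isBilinear.Build K poly poly poly *:%R *:%R pmul pmul_bilinear.

Definition free_nalg : nalg K := NAlg (pmul : {bilinear poly -> poly -> poly}).

End FreeAlgebra.

Section Evaluation.
Variables (K : fieldType) (A : nalg K) (a : nat -> A).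

Fixpoint meval (m : magma) : A :=
  match m with
  | MVar i => a i
  | MMul u v => nmul (meval u) (meval v)
  end.

Definition peval_fun (f : free_nalg K) : A :=
  \sum_(m <- msupp f) f@_m *: meval m.

HB.instance Definition _ := GRing.isLinear.Build K (free_nalg K) A *:%R
  peval_fun (linear_msupp meval).

Lemma peval_funU c m : peval_fun << c *g m >> = c *: meval m.
Proof.
rewrite /peval_fun msuppU; case: eqP => [->|_].
  by rewrite big_seq_fset0 scale0r.
by rewrite big_seq_fset1 mcoeffUU.
Qed.

Lemma peval_funM : mul_preserving (peval_fun : {linear free_nalg K -> A}).
Proof.
move=> f g /=; rewrite /nmul /= /pmul linear_sum /=.
rewrite [X in nmul X _]/peval_fun linear_sumlz.
apply: eq_bigr => u _; rewrite linear_sum linearZl_LR linear_sumr scaler_sumr.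
apply: eq_bigr => v _ /=.
by rewrite linearZr_LR peval_funU scalerA.
Qed.

Definition peval : nalg_hom (free_nalg K) A := exist _ _ peval_funM.

Lemma peval_var i : peval << MVar i >> = a i.
Proof. by rewrite /nalg_fun /= peval_funU scale1r. Qed.

Lemma peval_unique (h : nalg_hom (free_nalg K) A) :
  (forall i, h << MVar i >> = a i) -> h = peval.
Proof.
move=> ha; apply: nalg_homP => f.
have hm m : h << m >> = meval m.
  elim: m => [i|u IHu v IHv] /=; first exact: ha.
  rewrite -IHu -IHv /nalg_fun -(svalP h); congr (sval h _).
  by rewrite /nmul /= /pmul !msuppU oner_eq0 !big_seq_fset1 !mcoeffUU mulr1.
rewrite [in LHS](monalgE f) /nalg_fun linear_sum; apply: eq_bigr => m _ /=.
by rewrite -hm /nalg_fun -linearZ scale_malgU mulr1.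
Qed.

End Evaluation.

Fixpoint vars_below (n : nat) (m : magma) : bool :=
  match m with
  | MVar i => (i < n)%N
  | MMul u v => vars_below n u && vars_below n v
  end.

Section Varieties.
Variable K : fieldType.

(* psi = psi(x_1, ..., x_n): no variable outside x_1, ..., x_n occurs in psi. *)
Definition poly_in (n : nat) (psi : free_nalg K) : bool :=
  all (vars_below n) (msupp psi).

Lemma poly_in_exists (psi : free_nalg K) : exists n, poly_in n psi.
Proof.
have vb_le n p m : (n <= p)%N -> vars_below n m -> vars_below p m.
  move=> np; elim: m => [i /= /leq_trans -> //|u IHu v IHv /=].
  by case/andP => /IHu -> /IHv.
have vb m : exists n, vars_below n m.
  elim: m => [i|u [n Hu] v [p Hv]]; first by exists i.+1 => /=.
  by exists (maxn n p) => /=; rewrite (vb_le n) ?leq_maxl // (vb_le p) ?leq_maxr.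
rewrite /poly_in; elim: (enum_fset _) => [|m s [n IHs]]; first by exists 0%N.
have [p Hm] := vb m; exists (maxn n p) => /=.
rewrite (vb_le p) ?leq_maxr //=; apply: sub_all IHs => x.
by apply: vb_le; rewrite leq_maxl.
Qed.

(* psi(a_1, ..., a_n): the variables beyond x_n are sent to 0. *)
Definition peval_at (A : nalg K) (n : nat) (psi : free_nalg K)
  (a : n.-tuple A) : A := peval (fun i => nth 0 a i) psi.

Definition identity_of (A : nalg K) (psi : free_nalg K) : Prop :=
  forall n, poly_in n psi -> forall a : n.-tuple A, peval_at psi a = 0.

Definition in_variety (I : free_nalg K -> Prop) (A : Alg K) : Prop :=
  forall psi, I psi -> identity_of A psi.

Definition variety (I : free_nalg K -> Prop) : category :=
  full_subcategory (in_variety I).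

Definition variety_inclusion (I : free_nalg K -> Prop) :
  functor (variety I) (Alg K) := inclusion (in_variety I).

End Varieties.

(* Main.v *)
(** The reflection of an algebra A into the variety is A / J, where J is the
    smallest ideal containing all values psi(a_1, ..., a_n) of the polynomials
    psi in I at tuples of A.  Tuples of A / J lift to A, so A / J satisfies the
    identities in I; a morphism from A to an algebra of the variety commutes
    with evaluation of polynomials, so its kernel contains J and it factors
    uniquely through A / J.  Universal arrows assemble into a left adjoint. *)
From HB Require Import structures.
From mathcomp Require Import all_boot all_algebra.
From mathcomp Require Import generic_quotient ring_quotient boolp.
Require Import Defs.

Set Implicit Arguments.
Unset Strict Implicit.
Unset Printing Implicit Defensive.

Import GRing.Theory Quotient.
Local Open Scope ring_scope.
Local Open Scope quotient_scope.

(** * Left adjoints from universal arrows into a full subcategory *)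

Section ReflectiveSubcategory.
Variables (C : category) (P : C -> Prop).
Variables (R : C -> C) (R_in : forall a, P (R a)).
Variable eta : forall a, hom a (R a).
Variable lift : forall a b, P b -> hom a b -> hom (R a) b.
(** Together with [eta_inj], this makes [eta a] a universal arrow: factorizations through it exist
    and are unique. *)
Hypothesis lift_eta :
  forall a b (Pb : P b) (f : hom a b), comp (lift Pb f) (eta a) = f.
Hypothesis eta_inj : forall a b (Pb : P b) (g h : hom (R a) b),
  comp g (eta a) = comp h (eta a) -> g = h.

Definition reflection_obj (a : C) : full_subcategory P :=
  exist P (R a) (R_in a).

Definition reflection_map a b (f : hom a b) :
  hom (reflection_obj a) (reflection_obj b) :=
  lift (R_in b) (comp (eta b) f).

Lemma reflection_map_id a : reflection_map (idm a) = idm (reflection_obj a).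
Proof. by apply: (eta_inj (R_in a)); rewrite lift_eta comp_idr comp_idl. Qed.

Lemma reflection_map_comp a b c (g : hom b c) (f : hom a b) :
  reflection_map (comp g f) = comp (reflection_map g) (reflection_map f).
Proof.
apply: (eta_inj (R_in c)) => /=.
by rewrite /reflection_map lift_eta -compA lift_eta !compA lift_eta.
Qed.

Definition reflection : functor C (full_subcategory P) :=
  Functor reflection_map_id reflection_map_comp.

Lemma reflection_left_adjoint : is_left_adjoint reflection (inclusion P).
Proof.
split; apply: (@Adjunction _ _ reflection (inclusion P)
  (fun c d (g : hom (R c) (sval d)) => comp g (eta c))).
- move=> c d; exists (lift (svalP d)) => g; last exact: lift_eta.
  by apply: (eta_inj (svalP d)); apply: lift_eta.
(* Here [lift_eta] serves as naturality of [eta]. *)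
- by move=> c c' d f g /=; rewrite -compA lift_eta compA.
- by move=> c d d' g h /=; rewrite compA.
Qed.

End ReflectiveSubcategory.

(** * Two-sided ideals and quotient algebras *)

Section Ideals.
Variables (K : fieldType) (A : nalg K).

Record ideal := Ideal {
  ideal_set :> A -> Prop;
  ideal0 : ideal_set 0;
  idealD : forall x y, ideal_set x -> ideal_set y -> ideal_set (x + y);
  idealZ : forall c x, ideal_set x -> ideal_set (c *: x);
  idealMl : forall x y, ideal_set y -> ideal_set (nmul x y);
  idealMr : forall x y, ideal_set x -> ideal_set (nmul x y) }.

Variable J : ideal.

(** Classical logic makes membership boolean, as the quotient construction expects, for an arbitrary
    ideal. *)
Definition ideal_pred : A -> bool := fun x => `[< J x >].

Lemma ideal_predP x : reflect (J x) (x \in ideal_pred).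
Proof. exact: asboolP. Qed.

Lemma ideal_submod_closed : subsemimod_closed ideal_pred.
Proof.
split; first split.
- exact/ideal_predP/ideal0.
- by move=> x y /ideal_predP Jx /ideal_predP Jy; apply/ideal_predP/idealD.
- by move=> c x /ideal_predP Jx; apply/ideal_predP/idealZ.
Qed.

HB.instance Definition _ :=
  GRing.isSubmodClosed.Build K A ideal_pred ideal_submod_closed.

(** Only the additive group is divided out here. Scaling and product are added below through
    representatives; [pi_scale] and [pi_mul] show that the choice is irrelevant. *)
Definition ideal_quot : Type := {quot GRing.ZmodClosed.clone A ideal_pred _}.

HB.instance Definition _ := ZmodQuotient.on ideal_quot.

Lemma ideal_quotP x y : \pi_ideal_quot x = \pi_ideal_quot y <-> J (x - y).
Proof.
have piE : (x - y \in ideal_pred) = (\pi_ideal_quot x == \pi_ideal_quot y).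
  exact: idealrBE.
by rewrite (rwP eqP) -piE (rwP (ideal_predP _)).
Qed.

Lemma repr_pi_sub x : J (repr (\pi_ideal_quot x) - x).
Proof. by apply/ideal_quotP; rewrite reprK. Qed.

Definition quot_scale (c : K) (x : ideal_quot) : ideal_quot :=
  \pi_ideal_quot (c *: repr x).

Lemma pi_scale c x : quot_scale c (\pi_ideal_quot x) = \pi_ideal_quot (c *: x).
Proof. by apply/ideal_quotP; rewrite -scalerBr; apply/idealZ/repr_pi_sub. Qed.

Lemma quot_scaleA a b x : quot_scale a (quot_scale b x) = quot_scale (a * b) x.
Proof. by elim/quotW: x => x; rewrite (pi_scale b) !pi_scale scalerA. Qed.

Lemma quot_scale1 : left_id 1 quot_scale.
Proof. by elim/quotW => x; rewrite pi_scale scale1r. Qed.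

Lemma quot_scaleDr : right_distributive quot_scale +%R.
Proof.
move=> c; elim/quotW => x; elim/quotW => y.
by rewrite -raddfD !pi_scale scalerDr raddfD.
Qed.

Lemma quot_scaleDl x : {morph quot_scale^~ x : a b / a + b}.
Proof. by elim/quotW: x => x a b; rewrite !pi_scale scalerDl raddfD. Qed.

HB.instance Definition _ := GRing.Zmodule_isLmodule.Build K ideal_quot
  quot_scaleA quot_scale1 quot_scaleDr quot_scaleDl.

Lemma pi_linear : linear \pi_ideal_quot.
Proof. by move=> c x y; rewrite raddfD /= -pi_scale. Qed.

HB.instance Definition _ :=
  GRing.isLinear.Build K A ideal_quot *:%R \pi_ideal_quot pi_linear.

Definition quot_mul (x y : ideal_quot) : ideal_quot :=
  \pi_ideal_quot (nmul (repr x) (repr y)).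

Lemma pi_mul x y :
  quot_mul (\pi_ideal_quot x) (\pi_ideal_quot y) = \pi_ideal_quot (nmul x y).
Proof.
apply/ideal_quotP; set x' := repr _; set y' := repr _.
(* Without commutativity, the two summands need absorption on different sides. *)
have -> : nmul x' y' - nmul x y = nmul (x' - x) y' + nmul x (y' - y).
  by rewrite linearBl linearBr addrA subrK.
by apply: idealD; [apply: idealMr | apply: idealMl]; apply: repr_pi_sub.
Qed.

Lemma quot_mul_bilinear : bilinear_for *:%R *:%R quot_mul.
Proof.
split; elim/quotW => x c; elim/quotW => y; elim/quotW => z.
- by rewrite -linearP !pi_mul linearPl linearP.
- by rewrite -linearP !pi_mul linearPr linearP.
Qed.

HB.instance Definition _ := bilinear_isBilinear.Build K
  ideal_quot ideal_quot ideal_quot *:%R *:%R quot_mul quot_mul_bilinear.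

Definition quot_nalg : nalg K :=
  NAlg (quot_mul : {bilinear ideal_quot -> ideal_quot -> ideal_quot}).

Lemma quot_proj_mul :
  mul_preserving (\pi_ideal_quot : {linear A -> quot_nalg}).
Proof. by move=> x y; rewrite /= -pi_mul. Qed.

Definition quot_proj : nalg_hom A quot_nalg := exist _ _ quot_proj_mul.

Lemma quot_proj_surj y : exists x, y = quot_proj x.
Proof. by exists (repr y); rewrite /nalg_fun /= reprK. Qed.

Lemma quot_proj_eq0 x : J x -> quot_proj x = 0.
Proof.
move=> Jx; rewrite -(linear0 (sval quot_proj)).
by apply/ideal_quotP; rewrite subr0.
Qed.

(** Surjectivity of the projection gives the uniqueness half of the universal property. *)
Lemma quot_proj_epi (B : nalg K) (g h : nalg_hom quot_nalg B) :
  nalg_comp g quot_proj = nalg_comp h quot_proj -> g = h.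
Proof.
move=> gh; apply: nalg_homP => q; have [x ->] := quot_proj_surj q.
exact: (congr1 (fun k : nalg_hom A B => k x) gh).
Qed.

Section Lift.
Variables (B : nalg K) (f : nalg_hom A B).

(* The unused proof [fJ] lets the linear structure be inferred from the term. *)
Definition quot_lift_fun (fJ : forall x, J x -> f x = 0) (q : quot_nalg) : B :=
  f (repr q).

Hypothesis fJ : forall x, J x -> f x = 0.

(** The chosen representative differs from [x] by an element of [J], which [f] kills. *)
Lemma quot_lift_pi x : quot_lift_fun fJ (\pi_ideal_quot x) = f x.
Proof.
apply/eqP; rewrite -subr_eq0 /quot_lift_fun /nalg_fun -linearB; apply/eqP.
exact/fJ/repr_pi_sub.
Qed.

Lemma quot_lift_linear : linear (quot_lift_fun fJ).
Proof.
move=> c; elim/quotW => x; elim/quotW => y.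
by rewrite -linearP !quot_lift_pi /nalg_fun linearP.
Qed.

HB.instance Definition _ := GRing.isLinear.Build K quot_nalg B *:%R
  (quot_lift_fun fJ) quot_lift_linear.

Lemma quot_lift_mul :
  mul_preserving (quot_lift_fun fJ : {linear quot_nalg -> B}).
Proof.
elim/quotW => x; elim/quotW => y /=.
by rewrite {1}/nmul /= pi_mul !quot_lift_pi /nalg_fun (svalP f).
Qed.

Definition quot_lift : nalg_hom quot_nalg B := exist _ _ quot_lift_mul.

Lemma quot_lift_proj : nalg_comp quot_lift quot_proj = f.
Proof. by apply: nalg_homP => x; apply: quot_lift_pi. Qed.

End Lift.

End Ideals.

(** Evaluation followed by [f] is a morphism out of the free algebra, hence determined by its values
    on the variables. *)
Lemma nalg_hom_peval_at (K : fieldType) (A B : nalg K) (f : nalg_hom A B)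
    n (psi : free_nalg K) (a : n.-tuple A) :
  f (peval_at psi a) = peval_at psi (map_tuple f a).
Proof.
rewrite /peval_at.
rewrite -(peval_unique (h := nalg_comp f (peval (fun i => nth 0 a i)))) // => i.
transitivity (f (nth 0 a i)); first by congr (f _); apply: peval_var.
(* Variables beyond the tuple take the default value 0, which [f] preserves by linearity. *)
case: (ltnP i (size a)) => ai; first by rewrite (nth_map 0).
by rewrite !nth_default ?size_map //; apply: linear0.
Qed.

Section VerbalIdeal.
Variables (K : fieldType) (I : free_nalg K -> Prop) (A : nalg K).

(** Generating the ideal inductively makes its minimality an induction principle, which
    [verbal_kernel] uses. *)
Inductive verbal : A -> Prop :=
| verbal_value psi n (a : n.-tuple A) :
    I psi -> poly_in n psi -> verbal (peval_at psi a)
| verbal0 : verbal 0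
| verbalD x y : verbal x -> verbal y -> verbal (x + y)
| verbalZ c x : verbal x -> verbal (c *: x)
| verbalMl x y : verbal y -> verbal (nmul x y)
| verbalMr x y : verbal x -> verbal (nmul x y).

Definition verbal_ideal : ideal A :=
  Ideal verbal0 verbalD verbalZ verbalMl verbalMr.

Lemma quot_verbal_in_variety : in_variety I (quot_nalg verbal_ideal).
Proof.
move=> psi Ipsi n psi_n a.
(* Lifting [a] entrywise exhibits the value of [psi] as the projection of a generator of the
   ideal. *)
have -> : a = map_tuple (quot_proj verbal_ideal) (map_tuple repr a).
  apply: eq_from_tnth => i; rewrite !tnth_map.
  by rewrite /nalg_fun /= reprK.
by rewrite -nalg_hom_peval_at; apply/quot_proj_eq0/verbal_value.
Qed.

Lemma verbal_kernel (B : nalg K) (f : nalg_hom A B) (VB : in_variety I B) :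
  forall x, verbal_ideal x -> f x = 0.
Proof.
move=> x.
elim=> {x} [psi n a Ipsi psi_n||x y _ fx _ fy|c x _ fx|x y _ fy|x y _ fx].
- by rewrite nalg_hom_peval_at; apply: VB.
- exact: linear0.
- by rewrite /nalg_fun linearD [sval f x]fx [sval f y]fy addr0.
- by rewrite /nalg_fun linearZ [sval f x]fx /= scaler0.
- by rewrite /nalg_fun (svalP f) [sval f y]fy linear0r.
- by rewrite /nalg_fun (svalP f) [sval f x]fx linear0l.
Qed.

End VerbalIdeal.

Theorem proposition8p6 (K : fieldType) (I : free_nalg K -> Prop) :
  exists L : functor (Alg K) (variety I),
    is_left_adjoint L (variety_inclusion I).
Proof.
pose R (A : Alg K) : Alg K := quot_nalg (verbal_ideal I A).
pose eta (A : Alg K) : hom A (R A) := quot_proj (verbal_ideal I A).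
pose lift (A B : Alg K) (VB : in_variety I B) (f : hom A B) :
  hom (R A) B := quot_lift (verbal_kernel f VB).
have lift_eta (A B : Alg K) (VB : in_variety I B) (f : hom A B) :
    comp (lift A B VB f) (eta A) = f.
  exact: quot_lift_proj.
have eta_inj (A B : Alg K) (VB : in_variety I B)
    (g h : hom (R A) B) : comp g (eta A) = comp h (eta A) -> g = h.
  exact: quot_proj_epi.
have R_in (A : Alg K) : in_variety I (R A) by apply: quot_verbal_in_variety.
exists (reflection R_in lift_eta eta_inj).
exact: reflection_left_adjoint.
Qed.
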